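(* Let $X$ be a set and let $\mathcal{A}\subset\mathfrak{P}(X)$ be a Boolean algebra of subsets of $X$ equipped with a diffeology $\mathcal{D}$. Then there exists a unique Boolean diffeology on $\mathcal{A}$, minimal for inclusion, which contains $\mathcal{D}$.
   Context: A parametrization in a set $Z$ is a map $P:U\to Z$ with $U$ an open subset of some $\mathbb{R}^n$. A diffeology on $Z$ is a set of parametrizations in $Z$ (called plots) that contains all constant parametrizations, is local (a parametrization that is a plot in a neighborhood of each point of its domain is a plot), and is stable under precomposition with smooth maps between open subsets of Euclidean spaces. A map $f$ between diffeological spaces is smooth if $f\circ P$ is a plot for every plot $P$; products carry the product diffeology (plots are the maps whose components are plots). $\mathfrak{P}(X)$ is the set of all subsets of $X$. A diffeology on a Boolean algebra $\mathcal{A}\subset\mathfrak{P}(X)$ is called Boolean if the Boolean operations are smooth for it: union $\cup$, intersection $\cap$ and symmetric difference $\Delta$ as maps $\mathcal{A}\times\mathcal{A}\to\mathcal{A}$, and the complement $A\mapsto X\setminus A$ as a map $\mathcal{A}\to\mathcal{A}$. *)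

(* Defs.v *)
From HB Require Import structures.
From mathcomp Require Import all_boot all_order all_algebra.
From mathcomp Require Import boolp classical_sets functions reals.
From mathcomp Require Import topology normedtype derive measurable_structure.

Set Implicit Arguments.
Unset Strict Implicit.
Unset Printing Implicit Defensive.

Import Order.TTheory GRing.Theory Num.Theory.
Import numFieldNormedType.Exports.

Local Open Scope classical_set_scope.
Local Open Scope ring_scope.

(* For U open: all partial derivatives of f up to order k exist and are
   continuous on U. The values of f outside U are irrelevant. *)
Fixpoint Ck_on (R : realType) (m n : nat) (k : nat) (U : set 'rV[R]_m)
    (f : 'rV[R]_m -> 'rV[R]_n) : Prop :=
  (forall x, U x -> {for x, continuous f}) /\
  match k with
  | 0 => True
  | k'.+1 => forall i : 'I_m,
      (forall x, U x -> derivable f x (delta_mx 0 i)) /\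
      Ck_on k' U ('D_(delta_mx 0 i) f)
  end.

Definition smooth_on (R : realType) (m n : nat) (U : set 'rV[R]_m)
    (f : 'rV[R]_m -> 'rV[R]_n) : Prop :=
  forall k, Ck_on k U f.

(* A map U -> V is smooth when it is induced by a total function that is
   smooth on U; the choice of the extension outside U does not matter. *)
Definition smooth_between (R : realType) (m n : nat) (U : set 'rV[R]_m)
    (V : set 'rV[R]_n) (F : U -> V) : Prop :=
  exists2 f : 'rV[R]_m -> 'rV[R]_n,
    smooth_on U f & forall x : U, f (\val x) = \val (F x).

Record parametrization (R : realType) (Z : Type) := Parametrization {
  pdim : nat;
  pdom : set 'rV[R]_pdim;
  pdom_open : open pdom;
  pmap : pdom -> Z }.

(* A set being a function, automatic implicit arguments would hide p. *)
Arguments pdom {R Z} p _ : rename.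
Arguments pdom_open {R Z} p _ : rename.
Arguments pmap {R Z} p x : rename.

Definition precomp (R : realType) (Z : Type) (P : parametrization R Z)
    (m : nat) (V : set 'rV[R]_m) (Vo : open V) (F : V -> pdom P) :
    parametrization R Z :=
  Parametrization Vo (pmap P \o F).

Definition restrict_param (R : realType) (Z : Type) (P : parametrization R Z)
    (V : set 'rV[R]_(pdim P)) (Vo : open V) (VP : V `<=` pdom P) :
    parametrization R Z :=
  precomp Vo
    (fun x : V => exist (fun y => y \in pdom P) (\val x)
                        (mem_set (VP _ (set_mem (valP x))))).

Definition postcomp (R : realType) (Z Z' : Type) (f : Z -> Z')
    (P : parametrization R Z) : parametrization R Z' :=
  Parametrization (pdom_open P) (f \o pmap P).

Record diffeology (R : realType) (Z : Type) (D : set (parametrization R Z)) :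
    Prop := Diffeology {
  plot_cst : forall (n : nat) (U : set 'rV[R]_n) (Uo : open U) (z : Z),
    D (Parametrization Uo (fun=> z));
  plot_local : forall P : parametrization R Z,
    (forall x, pdom P x ->
      exists (V : set 'rV[R]_(pdim P)) (Vo : open V) (VP : V `<=` pdom P),
        V x /\ D (restrict_param Vo VP)) ->
    D P;
  plot_precomp : forall P : parametrization R Z, D P ->
    forall (m : nat) (V : set 'rV[R]_m) (Vo : open V) (F : V -> pdom P),
      smooth_between F -> D (precomp Vo F) }.

Definition smooth (R : realType) (Z Z' : Type)
    (D : set (parametrization R Z)) (D' : set (parametrization R Z'))
    (f : Z -> Z') : Prop :=
  forall P, D P -> D' (postcomp f P).

Definition prod_diffeology (R : realType) (Z Z' : Type)
    (D : set (parametrization R Z)) (D' : set (parametrization R Z')) :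
    set (parametrization R (Z * Z')) :=
  [set P | D (postcomp fst P) /\ D' (postcomp snd P)].

Record boolean_algebra (X : Type) (A : set (set X)) : Prop := BooleanAlgebra {
  alg_set0 : A set0;
  alg_setT : A setT;
  alg_setU : setU_closed A;
  alg_setI : setI_closed A;
  alg_setC : setC_closed A }.

Lemma alg_setY (X : Type) (A : set (set X)) (hA : boolean_algebra A)
  (S T : set X) : A S -> A T -> A (S `+` T).
Proof.
move=> AS AT; rewrite /setY !setDE.
by apply: (alg_setU hA); apply: (alg_setI hA) => //; apply: (alg_setC hA).
Qed.

Section BooleanOperations.
Variables (X : Type) (A : set (set X)) (hA : boolean_algebra A).

Definition algU (p : A * A) : A :=
  exist (fun S => S \in A) (\val p.1 `|` \val p.2)
    (mem_set (alg_setU hA (set_mem (valP p.1)) (set_mem (valP p.2)))).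

Definition algI (p : A * A) : A :=
  exist (fun S => S \in A) (\val p.1 `&` \val p.2)
    (mem_set (alg_setI hA (set_mem (valP p.1)) (set_mem (valP p.2)))).

Definition algY (p : A * A) : A :=
  exist (fun S => S \in A) (\val p.1 `+` \val p.2)
    (mem_set (alg_setY hA (set_mem (valP p.1)) (set_mem (valP p.2)))).

Definition algC (S : A) : A :=
  exist (fun S => S \in A) (~` \val S)
    (mem_set (alg_setC hA (set_mem (valP S)))).

End BooleanOperations.

Record boolean_diffeology (R : realType) (X : Type) (A : set (set X))
    (hA : boolean_algebra A) (D : set (parametrization R A)) : Prop :=
  BooleanDiffeology {
  bool_diffeology : diffeology D;
  smooth_algU : smooth (prod_diffeology D D) D (algU hA);
  smooth_algI : smooth (prod_diffeology D D) D (algI hA);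
  smooth_algY : smooth (prod_diffeology D D) D (algY hA);
  smooth_algC : smooth D D (algC hA) }.

(* Main.v *)
Require Import Defs.
From mathcomp Require Import all_boot all_order all_algebra.
From mathcomp Require Import boolp classical_sets functions reals.
From mathcomp Require Import topology normedtype derive measurable_structure.
Set Implicit Arguments.
Unset Strict Implicit.
Unset Printing Implicit Defensive.
Local Open Scope classical_set_scope.

(** Every axiom of a Boolean diffeology is a closure condition on the set of plots, so these
    diffeologies are stable under arbitrary intersection ([boolean_diffeology_bigcap]). The
    intersection of all those containing [D] is then the smallest one, and a smallest element is the
    only minimal one. *)

Lemma diffeology_bigcap (R : realType) (Z : Type)
    (F : set (set (parametrization R Z))) :
  F `<=` @diffeology R Z -> diffeology (\bigcap_(D in F) D).
Proof.
move=> FD; split.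
- by move=> n U Uo z D FD'; exact: (plot_cst (FD _ FD')).
- move=> P Ploc D FD'; apply: (plot_local (FD _ FD')) => x Px.
  (* The neighborhood given for the intersection serves every member of [F] at once. *)
  have [V [Vo [VP [Vx DV]]]] := Ploc x Px.
  by exists V, Vo, VP; split=> //; exact: DV.
- move=> P DP m V Vo f sf D FD'.
  by apply: (plot_precomp (FD _ FD')) => //; exact: DP.
Qed.

(** A pair of plots of the intersection is a pair of plots of each member, so the smoothness of the
    operations is checked member by member. *)
Lemma boolean_diffeology_bigcap (R : realType) (X : Type) (A : set (set X))
    (hA : boolean_algebra A) (F : set (set (parametrization R A))) :
  F `<=` boolean_diffeology hA -> boolean_diffeology hA (\bigcap_(D in F) D).
Proof.
move=> FB; split.
- by apply: diffeology_bigcap => D /FB /bool_diffeology.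
- move=> P [P1 P2] D FD; apply: (smooth_algU (FB _ FD)).
  by split; [exact: P1 | exact: P2].
- move=> P [P1 P2] D FD; apply: (smooth_algI (FB _ FD)).
  by split; [exact: P1 | exact: P2].
- move=> P [P1 P2] D FD; apply: (smooth_algY (FB _ FD)).
  by split; [exact: P1 | exact: P2].
- by move=> P DP D FD; apply: (smooth_algC (FB _ FD)); exact: DP.
Qed.

Theorem theorem6p5 (R : realType) (X : Type) (A : set (set X))
    (hA : boolean_algebra A) (D : set (parametrization R A))
    (hD : diffeology D) :
  exists! B : set (parametrization R A),
    [/\ boolean_diffeology hA B, D `<=` B &
        forall B' : set (parametrization R A),
          boolean_diffeology hA B' -> D `<=` B' -> B' `<=` B -> B' = B].
Proof.
pose F : set (set (parametrization R A)) :=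
  [set B | boolean_diffeology hA B /\ D `<=` B].
have bF : boolean_diffeology hA (\bigcap_(B in F) B).
  by apply: boolean_diffeology_bigcap => B [].
have DF : D `<=` \bigcap_(B in F) B by move=> P DP B [_]; exact.
exists (\bigcap_(B in F) B); split=> [|B [bB DB minB]].
- split=> // B bB DB BF; apply/seteqP; split=> // P; apply.
  by split.
(* A minimal [B] belongs to [F], hence contains the intersection; minimality, tested on the
   intersection itself, forces equality. *)
- by apply: minB => // P; apply; split.
Qed.
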